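(* Let $n\ge 3$ be an integer, $0<r<1$, $c=\cos\frac{\pi}{n}$, $\sigma=\sqrt{1-c^2}$ and $q=\sqrt{1-r^2}$, and let $x_1$ be a real number with $0<x_1<cr$. Put $$z_1=\tfrac{2-2crx_1+(c^2-1)r^2}{2q},\quad x_2=\tfrac{cr+x_1}{2},\quad y_2=\tfrac{r\sigma}{2},\quad x_3=c^2x_1,\quad z_3=\tfrac{2-2c^3rx_1+(c^2-1)r^2}{2q},\quad x_4=\tfrac{x_1}{2},\quad z_4=\tfrac{2-crx_1+(c^2-1)r^2}{2q}.$$ Let $\mathcal{R}_\Sigma$ be the reflection of $\mathbb{R}^3$ in the plane $\Sigma:\ \sigma x+cy=0$. Let $\boldsymbol{p}_1,\boldsymbol{p}_2,\boldsymbol{p}_3$ be the quadratic triangular Bézier patches with the control points $\boldsymbol{b}^1_{i,j,k},\boldsymbol{b}^2_{i,j,k},\boldsymbol{b}^3_{i,j,k}$, respectively, given by $$\boldsymbol{b}^1_{0,0,2}=(rc,-r\sigma,q),\quad \boldsymbol{b}^1_{2,0,0}=(rc,r\sigma,q),\quad \boldsymbol{b}^1_{0,2,0}=(x_1,0,z_1),\quad \boldsymbol{b}^1_{1,0,1}=\Big(\tfrac{cr}{1-(1-c^2)r^2},0,\tfrac{q}{1-(1-c^2)r^2}\Big),$$ $$\boldsymbol{b}^1_{0,1,1}=\Big(x_2,-y_2,\tfrac{1-r(cx_2+y_2\sigma)}{q}\Big),\quad \boldsymbol{b}^1_{1,1,0}=\Big(x_2,y_2,\tfrac{1-r(cx_2+y_2\sigma)}{q}\Big);$$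 $$\boldsymbol{b}^2_{0,0,2}=\boldsymbol{b}^1_{0,0,2},\quad \boldsymbol{b}^2_{0,1,1}=\boldsymbol{b}^1_{0,1,1},\quad \boldsymbol{b}^2_{0,2,0}=\boldsymbol{b}^1_{0,2,0},\quad \boldsymbol{b}^2_{1,0,1}=\mathcal{R}_\Sigma(\boldsymbol{b}^1_{0,1,1}),\quad \boldsymbol{b}^2_{1,1,0}=\big(x_3,-\tfrac{\sigma}{c}x_3,z_3\big),\quad \boldsymbol{b}^2_{2,0,0}=\mathcal{R}_\Sigma(\boldsymbol{b}^1_{0,2,0});$$ $$\boldsymbol{b}^3_{0,0,2}=\boldsymbol{b}^2_{0,2,0},\quad \boldsymbol{b}^3_{0,1,1}=\boldsymbol{b}^2_{1,1,0},\quad \boldsymbol{b}^3_{0,2,0}=\boldsymbol{b}^2_{2,0,0},\quad \boldsymbol{b}^3_{1,0,1}=(x_4,0,z_4),\quad \boldsymbol{b}^3_{1,1,0}=\mathcal{R}_\Sigma(\boldsymbol{b}^3_{1,0,1}),\quad \boldsymbol{b}^3_{2,0,0}=(0,0,z_4).$$ Consider the spline consisting of the $3n$ patches obtained from $\boldsymbol{p}_1,\boldsymbol{p}_2,\boldsymbol{p}_3$ by the rotations about the $z$-axis through the angles $\frac{2\pi k}{n}$, $k=0,\dots,n-1$. Then every patch is regular, i.e. $\frac{\partial\boldsymbol{p}_m}{\partial\xi}\times\frac{\partial\boldsymbol{p}_m}{\partial\eta}\neq 0$ on the whole of $\Delta$ for $m=1,2,3$; the spline is $G^1$ continuous; and for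 every $\xi\in[0,1]$ the normal to the tangent plane of $\boldsymbol{p}_1$ at the point $\boldsymbol{p}_1(\xi,0)$ of the outer boundary curve is parallel to the plane through the origin, $\boldsymbol{b}^1_{0,0,2}$ and $\boldsymbol{b}^1_{2,0,0}$ (which contains that boundary curve).
   Context: Let $\Delta=\{(\xi,\eta)\in\mathbb{R}^2: \xi,\eta\ge 0,\ \xi+\eta\le 1\}$. The quadratic triangular Bézier patch with control points $\boldsymbol{b}_{i,j,k}\in\mathbb{R}^3$, $i+j+k=2$, $i,j,k\ge 0$, is the map $\Delta\to\mathbb{R}^3$, $(\xi,\eta)\mapsto\sum_{i+j+k=2}\frac{2}{i!\,j!\,k!}\xi^i\eta^j(1-\xi-\eta)^k\boldsymbol{b}_{i,j,k}$. Combinatorially, the $3n$ patches correspond to the following triangulation of a regular $n$-gon with vertices $V_1,\dots,V_n$ and center $C$: inside it lies a smaller concentric regular $n$-gon with vertices $W_1,\dots,W_n$, rotated by $\pi/n$, and the triangles are $V_iV_{i+1}W_i$, $W_iW_{i+1}V_{i+1}$, $W_iW_{i+1}C$ ($V_{n+1}=V_1$, $W_{n+1}=W_1$). The patches $\boldsymbol{p}_1,\boldsymbol{p}_2,\boldsymbol{p}_3$ correspond to $V_1W_1V_2$, $V_1W_1W_n$, $W_1CW_n$, and patches are adjacent if their triangles share an edge. A spline of triangular patches is $G^1$ continuous if any two patches corresponding to triangles with a common edge share the same boundary curve over that edge and their tangent planes (the planes spanned by the first partial derivatives) coincide at every point of that common boundary curve. *)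

(* Defs.v *)
From Stdlib Require Import Arith Factorial Reals.
From Coquelicot Require Import Coquelicot.
Open Scope R_scope.

(* Addition and scaling on [R3] are Coquelicot's [plus] and [scal]. *)
Definition R3 : Type := (R * R * R)%type.

Definition cx (v : R3) : R := fst (fst v).
Definition cy (v : R3) : R := snd (fst v).
Definition cz (v : R3) : R := snd v.

Definition dot (u v : R3) : R := cx u * cx v + cy u * cy v + cz u * cz v.

Definition cross (u v : R3) : R3 :=
  (cy u * cz v - cz u * cy v,
   cz u * cx v - cx u * cz v,
   cx u * cy v - cy u * cx v).

Definition span2 (u v w : R3) : Prop :=
  exists s t : R, w = plus (scal s u) (scal t v).

(* Reflection in the plane through the origin with normal [N], for [N] nonzero. *)
Definition reflection (N v : R3) : R3 :=
  plus v (scal (- (2 * dot N v / dot N N)) N).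

Definition rotation_z (theta : R) (v : R3) : R3 :=
  (cos theta * cx v - sin theta * cy v,
   sin theta * cx v + cos theta * cy v,
   cz v).

Definition in_Delta (xi eta : R) : Prop := 0 <= xi /\ 0 <= eta /\ xi + eta <= 1.

(* The patch is the restriction of this polynomial map to the triangle
   [in_Delta]; partial derivatives at boundary points of the triangle are those
   of the polynomial map.  Only the values [b i j k] with i + j + k = 2 occur. *)
Definition bezier2 (b : nat -> nat -> nat -> R3) (xi eta : R) : R3 :=
  sum_n (fun i : nat =>
    sum_n (fun j : nat =>
      let k := (2 - i - j)%nat in
      scal (2 / (INR (fact i) * INR (fact j) * INR (fact k))
              * xi ^ i * eta ^ j * (1 - xi - eta) ^ k)
           (b i j k))
      (2 - i)%nat)
    2.

Definition d_xi (p : R -> R -> R3) (xi eta : R) : R3 :=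
  (Derive (fun s => cx (p s eta)) xi,
   Derive (fun s => cy (p s eta)) xi,
   Derive (fun s => cz (p s eta)) xi).

Definition d_eta (p : R -> R -> R3) (xi eta : R) : R3 :=
  (Derive (fun s => cx (p xi s)) eta,
   Derive (fun s => cy (p xi s)) eta,
   Derive (fun s => cz (p xi s)) eta).

Definition normal (p : R -> R -> R3) (xi eta : R) : R3 :=
  cross (d_xi p xi eta) (d_eta p xi eta).

Definition regular (p : R -> R -> R3) : Prop :=
  forall xi eta : R, in_Delta xi eta -> normal p xi eta <> (0, 0, 0).

(* Direction space of the tangent plane. *)
Definition tangent_plane (p : R -> R -> R3) (xi eta : R) : R3 -> Prop :=
  span2 (d_xi p xi eta) (d_eta p xi eta).

(* The corners of the parameter triangle; a quadratic patch takes the values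
   b_{2,0,0}, b_{0,2,0}, b_{0,0,2} there. *)
Inductive corner : Type := c200 | c020 | c002.

Definition corner_pt (a : corner) : R * R :=
  match a with
  | c200 => (1, 0)
  | c020 => (0, 1)
  | c002 => (0, 0)
  end.

Definition edge_pt (a a' : corner) (t : R) : R * R :=
  plus (scal (1 - t) (corner_pt a)) (scal t (corner_pt a')).

(* Vertices of the triangulation of the n-gon.  Indices run over 0, ..., n-1:
   [V k] and [W k] stand for V_{k+1} and W_{k+1}. *)
Inductive vertex : Type := V (k : nat) | W (k : nat) | Center.

Inductive kind : Type := K1 | K2 | K3.

(* [(m, k)] is the triangle of the m-th patch turned through the angle 2 k PI / n;
   for k = 0 the triangles are V_1 W_1 V_2, V_1 W_1 W_n and W_1 C W_n. *)
Definition tri : Type := (kind * nat)%type.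

Definition in_triangulation (n : nat) (T : tri) : Prop := (snd T < n)%nat.

Definition triangle_vertex (n : nat) (T : tri) (a : corner) : vertex :=
  let k := snd T in
  let next := (S k mod n)%nat in
  let prev := ((k + n - 1) mod n)%nat in
  match fst T, a with
  | K1, c002 => V k
  | K1, c020 => W k
  | K1, c200 => V next
  | K2, c002 => V k
  | K2, c020 => W k
  | K2, c200 => W prev
  | K3, c002 => W k
  | K3, c020 => W prev
  | K3, c200 => Center
  end.

Definition spline (n : nat) (p : kind -> R -> R -> R3) (T : tri)
    (xi eta : R) : R3 :=
  rotation_z (2 * PI * INR (snd T) / INR n) (p (fst T) xi eta).

(* The two boundary curves over a common edge are compared as maps from that
   edge, parametrised affinely between its two endpoints. *)
Definition G1_continuous (n : nat) (P : tri -> R -> R -> R3) : Prop :=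
  forall T T' : tri,
    in_triangulation n T -> in_triangulation n T' -> T <> T' ->
  forall a1 a2 a1' a2' : corner,
    a1 <> a2 ->
    triangle_vertex n T a1 = triangle_vertex n T' a1' ->
    triangle_vertex n T a2 = triangle_vertex n T' a2' ->
  forall t : R, 0 <= t <= 1 ->
    let (xi, eta) := edge_pt a1 a2 t in
    let (xi', eta') := edge_pt a1' a2' t in
    P T xi eta = P T' xi' eta' /\
    (forall v : R3,
       tangent_plane (P T) xi eta v <-> tangent_plane (P T') xi' eta' v).

(* Main.v *)
Require Import Defs.
From Stdlib Require Import Arith Lia Lra Reals FunctionalExtensionality.
From Coquelicot Require Import Coquelicot.
Open Scope R_scope.

(** Seen from above, the second and the third patch are affine triangles, and the
    projection of the first one has a positive Jacobian, so no normal is horizontal and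
    all patches are regular. For two patches with nonvanishing [z]-components of the
    normals, the tangent planes agree as soon as the normals are proportional, which
    along each shared edge is a polynomial identity modulo [sigma^2 = 1 - c^2] and
    [q^2 = 1 - r^2]. By the rotational symmetry only four edges matter: [V_1 W_1],
    [V_2 W_1], [W_1 W_n] and [W_1 C]. *)

(** * Coordinates and partial derivatives of a quadratic patch *)

Lemma R3_eq (u v : R3) : cx u = cx v -> cy u = cy v -> cz u = cz v -> u = v.
Proof.
destruct u as [[u1 u2] u3], v as [[v1 v2] v3]; unfold cx, cy, cz; simpl.
intros; subst; reflexivity.
Qed.

Definition quad (f : R3 -> R) (b : nat -> nat -> nat -> R3) (x y : R) : R :=
  let w := 1 - x - y in
  f (b 2 0 0)%nat * x ^ 2 + f (b 0 2 0)%nat * y ^ 2 + f (b 0 0 2)%nat * w ^ 2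
  + 2 * (f (b 1 1 0)%nat * x * y + f (b 1 0 1)%nat * x * w + f (b 0 1 1)%nat * y * w).

(** The derivative of a quadratic Bézier patch in [x] is twice the linear patch on the differences
    of control points in that direction. *)
Definition quad_xi (f : R3 -> R) (b : nat -> nat -> nat -> R3) (x y : R) : R :=
  2 * ((f (b 2 0 0)%nat - f (b 1 0 1)%nat) * x + (f (b 1 1 0)%nat - f (b 0 1 1)%nat) * y
       + (f (b 1 0 1)%nat - f (b 0 0 2)%nat) * (1 - x - y)).

Definition quad_eta (f : R3 -> R) (b : nat -> nat -> nat -> R3) (x y : R) : R :=
  2 * ((f (b 1 1 0)%nat - f (b 1 0 1)%nat) * x + (f (b 0 2 0)%nat - f (b 0 1 1)%nat) * y
       + (f (b 0 1 1)%nat - f (b 0 0 2)%nat) * (1 - x - y)).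

Lemma bezier2_quad (b : nat -> nat -> nat -> R3) (x y : R) :
  bezier2 b x y = (quad cx b x y, quad cy b x y, quad cz b x y).
Proof.
unfold bezier2, quad.
repeat (rewrite sum_Sn || rewrite sum_O); simpl Nat.sub.
repeat (rewrite sum_Sn || rewrite sum_O); simpl fact.
apply R3_eq; unfold cx, cy, cz, plus, scal; simpl; unfold plus, scal, mult; simpl;
  unfold mult; simpl; field.
Qed.

Lemma Derive_quad_xi (f : R3 -> R) (b : nat -> nat -> nat -> R3) (x y : R) :
  Derive (fun s => quad f b s y) x = quad_xi f b x y.
Proof.
apply is_derive_unique; unfold quad, quad_xi; auto_derive; [easy | ring].
Qed.

Lemma Derive_quad_eta (f : R3 -> R) (b : nat -> nat -> nat -> R3) (x y : R) :
  Derive (fun s => quad f b x s) y = quad_eta f b x y.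
Proof.
apply is_derive_unique; unfold quad, quad_eta; auto_derive; [easy | ring].
Qed.

(** Stated for any [p] agreeing pointwise with a Bézier patch, so that it also covers rotated
    patches, whose control points are the rotated ones. *)
Lemma d_xi_bezier2 (p : R -> R -> R3) (b : nat -> nat -> nat -> R3) (x y : R) :
  (forall s t, p s t = bezier2 b s t) ->
  d_xi p x y = (quad_xi cx b x y, quad_xi cy b x y, quad_xi cz b x y).
Proof.
intro H; unfold d_xi; rewrite <- !Derive_quad_xi.
f_equal; [f_equal |]; apply Derive_ext; intro s; rewrite H, bezier2_quad; reflexivity.
Qed.

Lemma d_eta_bezier2 (p : R -> R -> R3) (b : nat -> nat -> nat -> R3) (x y : R) :
  (forall s t, p s t = bezier2 b s t) ->
  d_eta p x y = (quad_eta cx b x y, quad_eta cy b x y, quad_eta cz b x y).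
Proof.
intro H; unfold d_eta; rewrite <- !Derive_quad_eta.
f_equal; [f_equal |]; apply Derive_ext; intro s; rewrite H, bezier2_quad; reflexivity.
Qed.

(** * Rotations about the [z]-axis *)

Lemma rotation_bezier2 (theta : R) (b : nat -> nat -> nat -> R3) (x y : R) :
  rotation_z theta (bezier2 b x y)
  = bezier2 (fun i j k => rotation_z theta (b i j k)) x y.
Proof.
rewrite !bezier2_quad; apply R3_eq; unfold quad, rotation_z, cx, cy, cz; simpl; ring.
Qed.

Lemma d_xi_rotation (theta : R) (b : nat -> nat -> nat -> R3) (x y : R) :
  d_xi (fun s t => rotation_z theta (bezier2 b s t)) x y
  = rotation_z theta (d_xi (bezier2 b) x y).
Proof.
rewrite (d_xi_bezier2 _ _ _ _ (rotation_bezier2 theta b)).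
rewrite (d_xi_bezier2 _ b) by reflexivity.
apply R3_eq; unfold quad_xi, rotation_z, cx, cy, cz; simpl; ring.
Qed.

Lemma d_eta_rotation (theta : R) (b : nat -> nat -> nat -> R3) (x y : R) :
  d_eta (fun s t => rotation_z theta (bezier2 b s t)) x y
  = rotation_z theta (d_eta (bezier2 b) x y).
Proof.
rewrite (d_eta_bezier2 _ _ _ _ (rotation_bezier2 theta b)).
rewrite (d_eta_bezier2 _ b) by reflexivity.
apply R3_eq; unfold quad_eta, rotation_z, cx, cy, cz; simpl; ring.
Qed.

Lemma rotation_add (alpha beta : R) (v : R3) :
  rotation_z alpha (rotation_z beta v) = rotation_z (alpha + beta) v.
Proof.
apply R3_eq; unfold rotation_z, cx, cy, cz; simpl; rewrite ?cos_plus, ?sin_plus; ring.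
Qed.

Lemma rotation_0 (v : R3) : rotation_z 0 v = v.
Proof.
apply R3_eq; unfold rotation_z, cx, cy, cz; simpl; rewrite ?cos_0, ?sin_0; ring.
Qed.

Lemma cz_cross_rotation (theta : R) (u v : R3) :
  cz (cross (rotation_z theta u) (rotation_z theta v)) = cz (cross u v).
Proof.
pose proof (sin2_cos2 theta) as H; unfold Rsqr in H.
unfold cross, rotation_z, cx, cy, cz; simpl.
(* The quantity is a planar determinant; inserting the determinant [sin ^ 2 + cos ^ 2 = 1] of the
   rotation leaves a polynomial identity. *)
replace (fst (fst u) * snd (fst v) - snd (fst u) * fst (fst v)) with
  ((sin theta * sin theta + cos theta * cos theta)
   * (fst (fst u) * snd (fst v) - snd (fst u) * fst (fst v))) by (rewrite H; ring).
ring.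
Qed.

(** * Tangent planes through their normals *)

Lemma span2_coord (u v w : R3) :
  span2 u v w <-> exists s t : R,
    cx w = s * cx u + t * cx v /\ cy w = s * cy u + t * cy v /\
    cz w = s * cz u + t * cz v.
Proof.
split; intros [s [t H]]; exists s, t.
- rewrite H; repeat split.
- apply R3_eq; apply H.
Qed.

Lemma span2_rotation (theta : R) (u v w : R3) :
  span2 (rotation_z theta u) (rotation_z theta v) w
  <-> span2 u v (rotation_z (- theta) w).
Proof.
assert (lin : forall a s t : R, rotation_z a (plus (scal s u) (scal t v))
  = plus (scal s (rotation_z a u)) (scal t (rotation_z a v))).
{ intros a s t; apply R3_eq; unfold rotation_z, cx, cy, cz, plus, scal; simpl;
    unfold plus, scal; simpl; unfold plus, scal, mult; simpl; unfold mult; simpl; ring. }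
split; intros [s [t H]]; exists s, t.
- rewrite H, <- lin, rotation_add, Rplus_opp_l; apply rotation_0.
- rewrite <- lin, <- H, rotation_add, Rplus_opp_r, rotation_0; reflexivity.
Qed.

(** The [z]-component of the cross product is the determinant of the [x] and [y] equations, so
    Cramer's rule solves these two; the third equation is then orthogonality to the normal. *)
Lemma span2_normal (u v w : R3) :
  cz (cross u v) <> 0 -> (span2 u v w <-> dot (cross u v) w = 0).
Proof.
rewrite span2_coord.
destruct u as [[u1 u2] u3], v as [[v1 v2] v3], w as [[w1 w2] w3].
unfold cross, dot, cx, cy, cz; simpl; intro H; split.
- intros [s [t [E1 [E2 E3]]]]; subst; ring.
- intro E.
  exists ((w1 * v2 - w2 * v1) / (u1 * v2 - u2 * v1)),
    ((u1 * w2 - u2 * w1) / (u1 * v2 - u2 * v1)).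
  split; [| split]; [field; exact H | field; exact H |].
  apply (Rmult_eq_reg_l (u1 * v2 - u2 * v1)); [| exact H].
  match type of E with ?l = 0 =>
    transitivity ((u1 * v2 - u2 * v1) * w3 - l); [rewrite E; ring |]
  end.
  field; exact H.
Qed.

(** * Contact of two patches along an edge *)

Definition joined (P P' : R -> R -> R3) (z z' : R * R) : Prop :=
  P (fst z) (snd z) = P' (fst z') (snd z') /\
  forall v, tangent_plane P (fst z) (snd z) v <-> tangent_plane P' (fst z') (snd z') v.

Definition joined_along (P P' : R -> R -> R3) (a1 a2 a1' a2' : corner) : Prop :=
  forall t : R, 0 <= t <= 1 -> joined P P' (edge_pt a1 a2 t) (edge_pt a1' a2' t).

Lemma joined_along_sym P P' a1 a2 a1' a2' :
  joined_along P P' a1 a2 a1' a2' -> joined_along P' P a1' a2' a1 a2.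
Proof.
intros H t ht; destruct (H t ht) as [H1 H2]; split; [easy |].
intro v; symmetry; apply H2.
Qed.

Lemma edge_pt_rev (a a' : corner) (t : R) : edge_pt a a' t = edge_pt a' a (1 - t).
Proof.
destruct a, a'; apply injective_projections; unfold plus, scal; simpl;
  unfold plus, scal, mult; simpl; unfold mult; simpl; ring.
Qed.

Lemma joined_along_rev P P' a1 a2 a1' a2' :
  joined_along P P' a1 a2 a1' a2' -> joined_along P P' a2 a1 a2' a1'.
Proof.
intros H t ht; rewrite (edge_pt_rev a2), (edge_pt_rev a2'); apply H; lra.
Qed.

(** Only the relative angle [alpha] of two patches matters, so each contact can be checked with the
    first patch unrotated. *)
Lemma joined_along_rotation (theta alpha : R) (b b' : nat -> nat -> nat -> R3)
    (a1 a2 a1' a2' : corner) :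
  joined_along (bezier2 b) (fun s t => rotation_z alpha (bezier2 b' s t)) a1 a2 a1' a2' ->
  joined_along (fun s t => rotation_z theta (bezier2 b s t))
    (fun s t => rotation_z (theta + alpha) (bezier2 b' s t)) a1 a2 a1' a2'.
Proof.
intros H t ht; destruct (H t ht) as [H1 H2]; split.
- rewrite H1; apply rotation_add.
- intro v; unfold tangent_plane in *.
  rewrite !d_xi_rotation, !d_eta_rotation, <- !rotation_add, !span2_rotation.
  rewrite H2, d_xi_rotation, d_eta_rotation, !span2_rotation; reflexivity.
Qed.

(** The last two equations express [N / cz N = N' / cz N'] without division; both planes are then
    the orthogonal complement of one direction. *)
Lemma joined_normal (P P' : R -> R -> R3) (z z' : R * R) :
  let N := normal P (fst z) (snd z) in
  let N' := normal P' (fst z') (snd z') in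
  P (fst z) (snd z) = P' (fst z') (snd z') ->
  cz N <> 0 -> cz N' <> 0 ->
  cx N * cz N' = cx N' * cz N -> cy N * cz N' = cy N' * cz N ->
  joined P P' z z'.
Proof.
intros N N' E h h' Ex Ey; split; [exact E |].
intro v; unfold tangent_plane; rewrite !span2_normal by assumption.
fold (normal P (fst z) (snd z)) (normal P' (fst z') (snd z')); fold N N'.
unfold dot.
assert (K : cz N' * (cx N * cx v + cy N * cy v + cz N * cz v)
  = cz N * (cx N' * cx v + cy N' * cy v + cz N' * cz v)).
{ transitivity ((cx N * cz N') * cx v + (cy N * cz N') * cy v + cz N * cz N' * cz v);
    [ring | rewrite Ex, Ey; ring]. }
split; intro Z; rewrite Z, Rmult_0_r in K.
- symmetry in K; apply Rmult_integral in K; tauto.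
- apply Rmult_integral in K; tauto.
Qed.

(** * Combinatorics of shared edges *)

(** One constructor for each type of interior edge, closed under reversing the edge and exchanging
    the triangles, the two symmetries of [joined_along]. *)
Inductive glued (n : nat) : tri -> tri -> corner -> corner -> corner -> corner -> Prop :=
| glued_VW k : glued n (K1, k) (K2, k) c002 c020 c002 c020
| glued_VW_next k : (k < n)%nat ->
    glued n (K1, k) (K2, (S k mod n)%nat) c200 c020 c002 c200
| glued_WW k : glued n (K2, k) (K3, k) c020 c200 c002 c020
| glued_WC k : (k < n)%nat ->
    glued n (K3, k) (K3, (S k mod n)%nat) c002 c200 c020 c200
| glued_rev T T' a1 a2 a1' a2' :
    glued n T T' a1 a2 a1' a2' -> glued n T T' a2 a1 a2' a1'
| glued_sym T T' a1 a2 a1' a2' :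
    glued n T T' a1 a2 a1' a2' -> glued n T' T a1' a2' a1 a2.

(** The wrap-around is a disjunction of linear facts, so that [lia] can settle equations between
    vertex indices. *)
Lemma succ_mod (n k : nat) : (k < n)%nat ->
  ((S k < n /\ S k mod n = S k) \/ (S k = n /\ S k mod n = 0))%nat.
Proof.
intro h; destruct (Nat.eq_dec (S k) n) as [e | e].
- right; split; [exact e | rewrite e; apply Nat.Div0.mod_same].
- left; split; [lia | apply Nat.mod_small; lia].
Qed.

Lemma pred_mod (n k : nat) : (k < n)%nat ->
  ((0 < k /\ (k + n - 1) mod n = k - 1) \/ (k = 0 /\ (k + n - 1) mod n = n - 1))%nat.
Proof.
intro h; destruct k as [| k].
- right; split; [easy | apply Nat.mod_small; lia].
- left; split; [lia |].
  replace (S k + n - 1)%nat with (k + 1 * n)%nat by lia.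
  rewrite Nat.Div0.mod_add, Nat.mod_small; lia.
Qed.

(** Finite check over kinds and corners. The bound on [n] excludes two triangles of the same kind
    with two vertices interchanged, such as [K1] triangles sharing both outer vertices when
    [n = 2]. *)
Lemma shared_edge_glued (n : nat) (T T' : tri) (a1 a2 a1' a2' : corner) :
  (3 <= n)%nat -> in_triangulation n T -> in_triangulation n T' -> T <> T' ->
  a1 <> a2 ->
  triangle_vertex n T a1 = triangle_vertex n T' a1' ->
  triangle_vertex n T a2 = triangle_vertex n T' a2' ->
  glued n T T' a1 a2 a1' a2'.
Proof.
destruct T as [m k], T' as [m' k']; unfold in_triangulation; simpl.
intros hn hk hk' hT ha E1 E2.
assert (hkk : m = m' -> k <> k') by (intros -> ->; apply hT; reflexivity).
clear hT.
pose proof (succ_mod n k hk); pose proof (succ_mod n k' hk').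
pose proof (pred_mod n k hk); pose proof (pred_mod n k' hk').
unfold triangle_vertex in E1, E2; cbn [fst snd] in E1, E2.
destruct m, m'; try specialize (hkk eq_refl);
destruct a1, a2; try (now elim ha); clear ha;
destruct a1'; try discriminate E1; destruct a2'; try discriminate E2;
try (injection E1 as E1); try (injection E2 as E2); try (exfalso; lia);
(* The remaining cases are genuine adjacencies: the indices are equal or cyclically consecutive. *)
try (first [ replace k' with k by lia | replace k' with (S k mod n)%nat by lia
      | replace k with (S k' mod n)%nat by lia ]);
(* The symmetry constructors always apply as well, so [+] lets [now] backtrack until one of the four
   basic edges fits. *)
try (now (constructor + (apply glued_rev; constructor) + (apply glued_sym; constructor)
  + (apply glued_rev, glued_sym; constructor))).
Qed.

(* The control points with all reflections evaluated; [s] is the paper's sigma and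
   [D] the denominator in b^1_{1,0,1}. *)
Definition control (r c s q x : R) (m : kind) (i j k : nat) : R3 :=
  let zW := (2 - 2 * c * r * x + (c ^ 2 - 1) * r ^ 2) / (2 * q) in
  let zM := (2 - 2 * c ^ 3 * r * x + (c ^ 2 - 1) * r ^ 2) / (2 * q) in
  let zC := (2 - c * r * x + (c ^ 2 - 1) * r ^ 2) / (2 * q) in
  let zVW := (1 - r * (c * ((c * r + x) / 2) + r * s / 2 * s)) / q in
  let D := 1 - (1 - c ^ 2) * r ^ 2 in
  let W := (x, 0, zW) in
  let W' := ((2 * c ^ 2 - 1) * x, - (2 * s * c * x), zW) in
  let VW := ((c * r + x) / 2, - (r * s / 2), zVW) in
  let WW' := (c ^ 2 * x, - (s * c * x), zM) in
  match m, i, j, k with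
  | K1, 0, 0, 2 | K2, 0, 0, 2 => (r * c, - (r * s), q)%R
  | K1, 2, 0, 0 => (r * c, r * s, q)%R
  | K1, 1, 0, 1 => (c * r / D, 0, q / D)%R
  | K1, 1, 1, 0 => ((c * r + x) / 2, r * s / 2, zVW)%R
  | K1, 0, 1, 1 | K2, 0, 1, 1 => VW
  | K1, 0, 2, 0 | K2, 0, 2, 0 | K3, 0, 0, 2 => W
  | K2, 1, 0, 1 =>
      (((2 * c ^ 2 - 1) * x + c * r) / 2, - (s * (2 * c * x + r) / 2), zVW)%R
  | K2, 1, 1, 0 | K3, 0, 1, 1 => WW'
  | K2, 2, 0, 0 | K3, 0, 2, 0 => W'
  | K3, 1, 0, 1 => (x / 2, 0, zC)%R
  | K3, 1, 1, 0 => ((2 * c ^ 2 - 1) * x / 2, - (s * c * x), zC)%R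
  | K3, 2, 0, 0 => (0, 0, zC)%R
  | _, _, _, _ => (0, 0, 0)%R
  end%nat.

(** * Nonvanishing Jacobians of the projected patches *)

(** Cosine and square roots survive only as signs and two polynomial relations, the form that
    [field] and [nra] can use. *)
Definition admissible (r c s q x : R) : Prop :=
  (0 < r /\ 0 < c /\ 0 < s /\ 0 < q) /\ 0 < x < c * r /\
  s ^ 2 = 1 - c ^ 2 /\ q ^ 2 = 1 - r ^ 2.

Lemma admissible_denominator (r c s q x : R) :
  admissible r c s q x -> 0 < 1 - (1 - c ^ 2) * r ^ 2 < 1.
Proof.
intros [[hr [hc [hs hq]]] [hx [es eq]]].
assert (h : 0 < s ^ 2 * r ^ 2 < 1).
{ split; [apply Rmult_lt_0_compat; apply pow_lt; assumption |].
  pose proof (pow_lt _ 2 hc); pose proof (pow_lt _ 2 hs); pose proof (pow_lt _ 2 hq).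
  pose proof (pow_lt _ 2 hr); nra. }
rewrite <- es; lra.
Qed.

Ltac unfold_coord := unfold cross, rotation_z, cx, cy, cz; cbn [fst snd].

Lemma cz_normal_neq0 (r c s q x : R) (m : kind) (xi eta : R) :
  admissible r c s q x -> in_Delta xi eta ->
  cz (normal (bezier2 (control r c s q x m)) xi eta) <> 0.
Proof.
intros H [h1 [h2 h3]].
pose proof (admissible_denominator _ _ _ _ _ H) as HD.
destruct H as [[hr [hc [hs hq]]] [hx [es eq]]].
unfold normal; rewrite (d_xi_bezier2 _ _ _ _ (fun _ _ => eq_refl)),
  (d_eta_bezier2 _ _ _ _ (fun _ _ => eq_refl)).
unfold quad_xi, quad_eta, control; destruct m; unfold_coord.
- (* [1 - D = (s r)^2 >= 0] and [x < c r] make the Jacobian positive. *)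
  set (D := 1 - (1 - c ^ 2) * r ^ 2) in *.
  match goal with |- ?e <> 0 => replace e with
    (2 * r * s * (c * r * ((1 - D) / D) * (1 - eta) + (c * r - x))) by (field; lra) end.
  apply Rgt_not_eq.
  assert (0 <= c * r * ((1 - D) / D) * (1 - eta)).
  { repeat apply Rmult_le_pos; try lra.
    apply Rlt_le, Rinv_0_lt_compat; lra. }
  repeat apply Rmult_lt_0_compat; lra.
(* The Jacobian of an affine triangle is twice its signed area, here negative by orientation;
   [c * x < c ^ 2 * r < r] gives its sign. *)
- match goal with |- ?e <> 0 => replace e with (- (2 * s * x * (r - c * x))) end.
  + assert (c * c < 1) by nra.
    assert (0 < r - c * x) by nra.
    apply Rlt_not_eq, Ropp_lt_gt_0_contravar.
    repeat apply Rmult_lt_0_compat; lra.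
  + field [es]; lra.
- match goal with |- ?e <> 0 => replace e with (2 * s * c * x * x) by (field [es]; lra) end.
  apply Rgt_not_eq; repeat apply Rmult_lt_0_compat; lra.
Qed.

Lemma edge_pt_in_Delta (a a' : corner) (t : R) :
  0 <= t <= 1 -> in_Delta (fst (edge_pt a a' t)) (snd (edge_pt a a' t)).
Proof.
intro ht; unfold in_Delta, edge_pt, plus, scal; destruct a, a'; simpl;
  unfold plus, scal, mult; simpl; unfold mult; simpl; lra.
Qed.

(** * Contact along the four types of edges *)

(** The equations are identities in [t], hence asked for every real [t]; the range of [t] enters
    only through the nonvanishing of the normals. *)
Lemma joined_patches (r c s q x alpha : R) (m m' : kind) (a1 a2 a1' a2' : corner) :
  admissible r c s q x ->
  let p := bezier2 (control r c s q x m) in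
  let p' := fun u v => rotation_z alpha (bezier2 (control r c s q x m') u v) in
  (forall t,
    let z := edge_pt a1 a2 t in
    let z' := edge_pt a1' a2' t in
    let N := normal p (fst z) (snd z) in
    let N' := normal p' (fst z') (snd z') in
    p (fst z) (snd z) = p' (fst z') (snd z') /\
    cx N * cz N' = cx N' * cz N /\ cy N * cz N' = cy N' * cz N) ->
  joined_along p p' a1 a2 a1' a2'.
Proof.
intros H p p' E t ht; destruct (E t) as [E1 [E2 E3]].
apply joined_normal; trivial.
- apply cz_normal_neq0; [exact H | apply edge_pt_in_Delta, ht].
- unfold normal, p'; rewrite d_xi_rotation, d_eta_rotation, cz_cross_rotation.
  apply cz_normal_neq0; [exact H | apply edge_pt_in_Delta, ht].
Qed.

Ltac expand_patches :=
  unfold edge_pt, normal; cbn zeta;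
  rewrite ?d_xi_rotation, ?d_eta_rotation,
    ?(d_xi_bezier2 _ _ _ _ (fun _ _ => eq_refl)),
    ?(d_eta_bezier2 _ _ _ _ (fun _ _ => eq_refl)), ?bezier2_quad;
  unfold quad, quad_xi, quad_eta, control, plus, scal; simpl;
  unfold plus, scal, mult; simpl; unfold mult; simpl;
  unfold_coord.

Ltac solve_joined H cos_alpha sin_alpha :=
  apply joined_patches; [exact H | intro t];
  pose proof (admissible_denominator _ _ _ _ _ H);
  destruct H as [[? [? [? ?]]] [? [es eq]]];
  expand_patches; rewrite cos_alpha, sin_alpha;
  split; [apply R3_eq; unfold_coord | split]; field [es eq]; lra.

Lemma joined_VW (r c s q x : R) :
  admissible r c s q x ->
  joined_along (bezier2 (control r c s q x K1))
    (fun u v => rotation_z 0 (bezier2 (control r c s q x K2) u v)) c002 c020 c002 c020.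
Proof. intro H; solve_joined H cos_0 sin_0. Qed.

(** Here [alpha] stands for twice the angle with cosine [c] and sine [s]. Rotation by it is the
    reflection in the plane [s * x + c * y = 0] followed by [y -> - y], which carries the reflected
    control points of [K2] to those of [K1] on this edge. *)
Lemma joined_VW_next (r c s q x alpha : R) :
  admissible r c s q x ->
  cos alpha = 2 * c ^ 2 - 1 -> sin alpha = 2 * s * c ->
  joined_along (bezier2 (control r c s q x K1))
    (fun u v => rotation_z alpha (bezier2 (control r c s q x K2) u v)) c200 c020 c002 c200.
Proof. intros H Hc Hs; solve_joined H Hc Hs. Qed.

Lemma joined_WW (r c s q x : R) :
  admissible r c s q x ->
  joined_along (bezier2 (control r c s q x K2))
    (fun u v => rotation_z 0 (bezier2 (control r c s q x K3) u v)) c020 c200 c002 c020.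
Proof. intro H; solve_joined H cos_0 sin_0. Qed.

Lemma joined_WC (r c s q x alpha : R) :
  admissible r c s q x ->
  cos alpha = 2 * c ^ 2 - 1 -> sin alpha = 2 * s * c ->
  joined_along (bezier2 (control r c s q x K3))
    (fun u v => rotation_z alpha (bezier2 (control r c s q x K3) u v)) c002 c200 c020 c200.
Proof. intros H Hc Hs; solve_joined H Hc Hs. Qed.

(** At the last index the angle is [0] on one side and a full turn on the other, which is the same
    rotation. *)
Lemma rotation_succ_mod (n k : nat) (v : R3) : (k < n)%nat ->
  rotation_z (2 * PI * INR (S k mod n) / INR n) v
  = rotation_z (2 * PI * INR k / INR n + 2 * PI / INR n) v.
Proof.
intro h; assert (hn : INR n <> 0) by (apply not_0_INR; lia).
destruct (succ_mod n k h) as [[_ ->] | [e ->]].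
- f_equal; rewrite S_INR; field; exact hn.
- replace (2 * PI * INR k / INR n + 2 * PI / INR n) with (2 * PI).
  + replace (2 * PI * INR 0 / INR n) with 0 by (simpl; field; exact hn).
    unfold rotation_z; rewrite cos_2PI, sin_2PI, cos_0, sin_0; reflexivity.
  + rewrite <- e, S_INR in *; field; exact hn.
Qed.

Lemma glued_joined (n : nat) (r c s q x : R) (T T' : tri) (a1 a2 a1' a2' : corner) :
  admissible r c s q x ->
  cos (2 * PI / INR n) = 2 * c ^ 2 - 1 -> sin (2 * PI / INR n) = 2 * s * c ->
  glued n T T' a1 a2 a1' a2' ->
  let P := spline n (fun m => bezier2 (control r c s q x m)) in
  joined_along (P T) (P T') a1 a2 a1' a2'.
Proof.
intros H Hc Hs G P.
(* The basic edges join patches of equal index ([same], relative angle zero) or of cyclically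
   consecutive index ([next], one step of the rotation). *)
assert (same : forall m m' k a1 a2 a1' a2',
  joined_along (bezier2 (control r c s q x m))
    (fun u v => rotation_z 0 (bezier2 (control r c s q x m') u v)) a1 a2 a1' a2' ->
  joined_along (P (m, k)) (P (m', k)) a1 a2 a1' a2').
{ intros m m' k b1 b2 b1' b2' J.
  apply (joined_along_rotation (2 * PI * INR k / INR n)) in J.
  rewrite Rplus_0_r in J; exact J. }
assert (next : forall m m' k a1 a2 a1' a2', (k < n)%nat ->
  joined_along (bezier2 (control r c s q x m))
    (fun u v => rotation_z (2 * PI / INR n) (bezier2 (control r c s q x m') u v))
    a1 a2 a1' a2' ->
  joined_along (P (m, k)) (P (m', (S k mod n)%nat)) a1 a2 a1' a2').
{ intros m m' k b1 b2 b1' b2' hk J.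
  apply (joined_along_rotation (2 * PI * INR k / INR n)) in J.
  replace (P (m', (S k mod n)%nat)) with
    (fun u v => rotation_z (2 * PI * INR k / INR n + 2 * PI / INR n)
      (bezier2 (control r c s q x m') u v)); [exact J |].
  apply functional_extensionality; intro u; apply functional_extensionality; intro v.
  symmetry; apply rotation_succ_mod, hk. }
induction G.
- apply same, joined_VW, H.
- apply next, joined_VW_next; assumption.
- apply same, joined_WW, H.
- apply next, joined_WC; assumption.
- apply joined_along_rev; assumption.
- apply joined_along_sym; assumption.
Qed.

(** * The plane of the outer boundary curve *)

Lemma span2_outer_boundary (r c s q x xi : R) (A := control r c s q x K1 0 0 2)
    (B := control r c s q x K1 2 0 0) :
  admissible r c s q x ->
  span2 A B (bezier2 (control r c s q x K1) xi 0) /\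
  span2 A B (normal (bezier2 (control r c s q x K1)) xi 0).
Proof.
intro H.
pose proof (admissible_denominator _ _ _ _ _ H) as HD.
destruct H as [[hr [hc [hs hq]]] [hx [es eq]]].
split; apply span2_coord.
(* With [D] the denominator, the middle control point of the boundary is [(A + B) / (2 * D)], so its
   weight [2 * xi * (1 - xi)] contributes equally to both coefficients. *)
- exists ((1 - xi) ^ 2 + xi * (1 - xi) / (1 - (1 - c ^ 2) * r ^ 2)),
    (xi ^ 2 + xi * (1 - xi) / (1 - (1 - c ^ 2) * r ^ 2)).
  unfold A, B; expand_patches; repeat split; field; lra.
- set (N := normal _ _ _).
  (* The plane spanned by [A] and [B] has equation [r * c * z = q * x]; the coefficients below solve
     the [x] and [y] equations, and [E] supplies the third. *)
  assert (E : r * c * cz N = q * cx N).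
  { unfold N; expand_patches; field [es eq]; lra. }
  clearbody N; destruct N as [[N1 N2] N3].
  exists ((N1 / (r * c) - N2 / (r * s)) / 2), ((N1 / (r * c) + N2 / (r * s)) / 2).
  unfold A, B, control; unfold cx, cy, cz in *; cbn [fst snd] in *; repeat split.
  + field; lra.
  + field; lra.
  + apply (Rmult_eq_reg_l (r * c)); [rewrite E; field; lra | nra].
Qed.

(** * Identification with the given control points, and conclusion *)

(** Index triples with sum other than two are unconstrained in the given data and zero in [control];
    a patch sees only the six others. *)
Lemma bezier2_ext (b b' : nat -> nat -> nat -> R3) :
  b 2%nat 0%nat 0%nat = b' 2%nat 0%nat 0%nat ->
  b 0%nat 2%nat 0%nat = b' 0%nat 2%nat 0%nat ->
  b 0%nat 0%nat 2%nat = b' 0%nat 0%nat 2%nat ->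
  b 1%nat 1%nat 0%nat = b' 1%nat 1%nat 0%nat ->
  b 1%nat 0%nat 1%nat = b' 1%nat 0%nat 1%nat ->
  b 0%nat 1%nat 1%nat = b' 0%nat 1%nat 1%nat ->
  bezier2 b = bezier2 b'.
Proof.
intros H1 H2 H3 H4 H5 H6.
apply functional_extensionality; intro u; apply functional_extensionality; intro v.
rewrite !bezier2_quad; unfold quad; rewrite H1, H2, H3, H4, H5, H6; reflexivity.
Qed.

Lemma reflection_coord (s c : R) (v : R3) :
  s ^ 2 = 1 - c ^ 2 ->
  reflection (s, c, 0) v =
    ((2 * c ^ 2 - 1) * cx v - 2 * s * c * cy v,
     - (2 * s * c * cx v) - (2 * c ^ 2 - 1) * cy v, cz v).
Proof.
intro es; destruct v as [[v1 v2] v3].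
assert (h : s * s + c * c + 0 * 0 = 1) by lra.
unfold reflection, dot; apply R3_eq; unfold_coord; rewrite h; unfold plus, scal; simpl;
  unfold plus, scal, mult; simpl; unfold mult; simpl; field [es].
Qed.

Lemma cos_sin_PI_div (n : nat) :
  (3 <= n)%nat -> 0 < cos (PI / INR n) < 1 /\ 0 < sin (PI / INR n).
Proof.
intro hn; assert (h : 3 <= INR n) by (apply (le_INR 3) in hn; simpl in hn; lra).
pose proof PI_RGT_0 as hPI.
assert (0 < PI / INR n) by (apply Rdiv_lt_0_compat; lra).
assert (PI / INR n < PI / 2).
{ apply Rmult_lt_compat_l; [lra |]; apply Rinv_lt_contravar; nra. }
split; [split; [apply cos_gt_0; lra |] | apply sin_gt_0; lra].
rewrite <- cos_0; apply cos_decreasing_1; lra.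
Qed.

Theorem mainTheorem2
  (n : nat) (r c sigma q x1 z1 x2 y2 x3 z3 x4 z4 : R)
  (b : kind -> nat -> nat -> nat -> R3)
  (hn : (3 <= n)%nat)
  (hr : 0 < r < 1)
  (hc : c = cos (PI / INR n))
  (hsigma : sigma = sqrt (1 - c ^ 2))
  (hq : q = sqrt (1 - r ^ 2))
  (hx1 : 0 < x1 < c * r)
  (hz1 : z1 = (2 - 2 * c * r * x1 + (c ^ 2 - 1) * r ^ 2) / (2 * q))
  (hx2 : x2 = (c * r + x1) / 2)
  (hy2 : y2 = r * sigma / 2)
  (hx3 : x3 = c ^ 2 * x1)
  (hz3 : z3 = (2 - 2 * c ^ 3 * r * x1 + (c ^ 2 - 1) * r ^ 2) / (2 * q))
  (hx4 : x4 = x1 / 2)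
  (hz4 : z4 = (2 - c * r * x1 + (c ^ 2 - 1) * r ^ 2) / (2 * q))
  (h1_002 : b K1 0%nat 0%nat 2%nat = (r * c, - (r * sigma), q))
  (h1_200 : b K1 2%nat 0%nat 0%nat = (r * c, r * sigma, q))
  (h1_020 : b K1 0%nat 2%nat 0%nat = (x1, 0, z1))
  (h1_101 : b K1 1%nat 0%nat 1%nat =
     (c * r / (1 - (1 - c ^ 2) * r ^ 2), 0, q / (1 - (1 - c ^ 2) * r ^ 2)))
  (h1_011 : b K1 0%nat 1%nat 1%nat =
     (x2, - y2, (1 - r * (c * x2 + y2 * sigma)) / q))
  (h1_110 : b K1 1%nat 1%nat 0%nat =
     (x2, y2, (1 - r * (c * x2 + y2 * sigma)) / q))
  (h2_002 : b K2 0%nat 0%nat 2%nat = b K1 0%nat 0%nat 2%nat)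
  (h2_011 : b K2 0%nat 1%nat 1%nat = b K1 0%nat 1%nat 1%nat)
  (h2_020 : b K2 0%nat 2%nat 0%nat = b K1 0%nat 2%nat 0%nat)
  (h2_101 : b K2 1%nat 0%nat 1%nat =
     reflection (sigma, c, 0) (b K1 0%nat 1%nat 1%nat))
  (h2_110 : b K2 1%nat 1%nat 0%nat = (x3, - (sigma / c * x3), z3))
  (h2_200 : b K2 2%nat 0%nat 0%nat =
     reflection (sigma, c, 0) (b K1 0%nat 2%nat 0%nat))
  (h3_002 : b K3 0%nat 0%nat 2%nat = b K2 0%nat 2%nat 0%nat)
  (h3_011 : b K3 0%nat 1%nat 1%nat = b K2 1%nat 1%nat 0%nat)
  (h3_020 : b K3 0%nat 2%nat 0%nat = b K2 2%nat 0%nat 0%nat)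
  (h3_101 : b K3 1%nat 0%nat 1%nat = (x4, 0, z4))
  (h3_110 : b K3 1%nat 1%nat 0%nat =
     reflection (sigma, c, 0) (b K3 1%nat 0%nat 1%nat))
  (h3_200 : b K3 2%nat 0%nat 0%nat = (0, 0, z4)) :
  let p := fun m : kind => bezier2 (b m) in
  let b002 := b K1 0%nat 0%nat 2%nat in
  let b200 := b K1 2%nat 0%nat 0%nat in
  (forall m : kind, regular (p m)) /\
  (forall T : tri, in_triangulation n T -> regular (spline n p T)) /\
  G1_continuous n (spline n p) /\
  (forall xi : R, 0 <= xi <= 1 ->
     span2 b002 b200 (p K1 xi 0) /\
     span2 b002 b200 (normal (p K1) xi 0)).
Proof.
intros p b002 b200.
destruct (cos_sin_PI_div n hn) as [hc1 hs1]; rewrite <- hc in hc1.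
assert (hn0 : INR n <> 0) by (apply not_0_INR; lia).
assert (hs0 : 0 < 1 - c ^ 2) by nra.
assert (hq0 : 0 < 1 - r ^ 2) by nra.
assert (es : sigma ^ 2 = 1 - c ^ 2) by (rewrite hsigma; apply pow2_sqrt; lra).
assert (eq : q ^ 2 = 1 - r ^ 2) by (rewrite hq; apply pow2_sqrt; lra).
assert (hs : 0 < sigma) by (rewrite hsigma; apply sqrt_lt_R0; exact hs0).
assert (hq' : 0 < q) by (rewrite hq; apply sqrt_lt_R0; exact hq0).
assert (Hadm : admissible r c sigma q x1) by (repeat split; tauto || lra).
pose proof (admissible_denominator _ _ _ _ _ Hadm) as HD.
assert (hsin : sin (PI / INR n) = sigma).
(* The root of [1 - cos ^ 2] is the sine itself because the sine is positive. *)
{ rewrite hsigma, hc, <- Rsqr_pow2, <- sin2; symmetry; apply sqrt_Rsqr; lra. }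
assert (Hp : p = fun m => bezier2 (control r c sigma q x1 m)).
{ clear hq hsigma.
  apply functional_extensionality; intro m; unfold p.
  destruct m; apply bezier2_ext;
    (* [h3_101] is repeated because [h3_110] brings that control point back under the reflection. *)
    rewrite ?h3_002, ?h3_011, ?h3_020, ?h3_101, ?h3_110, ?h3_200, ?h3_101,
      ?h2_002, ?h2_011, ?h2_020, ?h2_101, ?h2_110, ?h2_200,
      ?h1_002, ?h1_011, ?h1_020, ?h1_101, ?h1_110, ?h1_200,
      ?reflection_coord by exact es;
    subst x2 y2 x3 x4 z1 z3 z4;
    apply R3_eq; unfold control; unfold_coord; field [es]; lra. }
assert (Hcos : cos (2 * PI / INR n) = 2 * c ^ 2 - 1).
{ replace (2 * PI / INR n) with (2 * (PI / INR n)) by (field; exact hn0).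
  rewrite cos_2a_cos, <- hc; ring. }
assert (Hsin : sin (2 * PI / INR n) = 2 * sigma * c).
{ replace (2 * PI / INR n) with (2 * (PI / INR n)) by (field; exact hn0).
  rewrite sin_2a, hsin, <- hc; ring. }
assert (Hreg : forall m xi eta, in_Delta xi eta -> cz (normal (p m) xi eta) <> 0).
{ intros m xi eta h; rewrite Hp; apply cz_normal_neq0; assumption. }
split; [| split; [| split]].
- intros m xi eta h E; apply (Hreg m xi eta h); rewrite E; reflexivity.
- intros [m k] _ xi eta h E; apply (Hreg m xi eta h).
  (* Rotation about the [z]-axis keeps the [z]-component of the normal, so regularity passes to
     every rotated copy. *)
  transitivity (cz (normal (spline n p (m, k)) xi eta)); [| rewrite E; reflexivity].
  unfold spline, p, normal; cbn [fst snd].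
  rewrite d_xi_rotation, d_eta_rotation, cz_cross_rotation; reflexivity.
- intros T T' hT hT' hTT a1 a2 a1' a2' ha E1 E2 t ht.
  pose proof (shared_edge_glued n T T' a1 a2 a1' a2' hn hT hT' hTT ha E1 E2) as G.
  pose proof (glued_joined n _ _ _ _ _ T T' a1 a2 a1' a2' Hadm Hcos Hsin G t ht) as J.
  rewrite <- Hp in J; unfold joined in J.
  destruct (edge_pt a1 a2 t), (edge_pt a1' a2' t); exact J.
- intros xi _; rewrite Hp; unfold b002, b200; rewrite h1_002, h1_200.
  apply span2_outer_boundary, Hadm.
Qed.
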